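(* Let $S$ be a set of $n\geqslant5$ points in $\mathbb{R}^3$ such that the points of $S$ do not all lie on one sphere, do not all lie on one plane, no four points of $S$ lie on a common circle, and no three points of $S$ are collinear. Then there are at least $\frac{9}{208}\binom{n}{3}$ spheres containing exactly four points of $S$. *)

(* Defs.v *)
From mathcomp Require Import all_boot all_order all_algebra finmap.
From mathcomp Require Import all_classical all_reals.

Set Implicit Arguments.
Unset Strict Implicit.
Unset Printing Implicit Defensive.

Import Order.TTheory GRing.Theory Num.Theory.

Local Open Scope classical_set_scope.
Local Open Scope ring_scope.

Section Geometry.
Variable R : realType.
Implicit Types (A : set 'rV[R]_3) (S : {fset 'rV[R]_3}).

(* The norm that the library puts on 'rV[R]_3 is the sup norm, hence this
   Euclidean distance. *)
Definition edist (x y : 'rV[R]_3) : R :=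
  Num.sqrt (\sum_(i < 3) (x 0 i - y 0 i) ^+ 2).

Definition sphere (c : 'rV[R]_3) (r : R) : set 'rV[R]_3 :=
  [set x | edist x c = r].

Definition plane (u : 'rV[R]_3) (d : R) : set 'rV[R]_3 :=
  [set x | \sum_(i < 3) u 0 i * x 0 i = d].

Definition line (p v : 'rV[R]_3) : set 'rV[R]_3 :=
  [set x | exists t : R, x = p + t *: v].

(* Spheres and circles have positive radius: a point is neither. *)
Definition is_sphere A := exists c r, 0 < r /\ A = sphere c r.

Definition is_plane A := exists u d, u != 0 /\ A = plane u d.

Definition is_line A := exists p v, v != 0 /\ A = line p v.

Definition is_circle A :=
  exists P c r, [/\ is_plane P, P c, 0 < r & A = P `&` sphere c r].

Definition cospherical S := exists A, is_sphere A /\ [set` S] `<=` A.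

Definition coplanar S := exists A, is_plane A /\ [set` S] `<=` A.

Definition concyclic S := exists A, is_circle A /\ [set` S] `<=` A.

Definition collinear S := exists A, is_line A /\ [set` S] `<=` A.

Definition four_point_spheres S : set (set 'rV[R]_3) :=
  [set A | is_sphere A /\ #|` [fset x in S | x \in A]%fset | = 4%N].

End Geometry.

(* Main.v *)
(** For two points p, q of S, the centres of the spheres through p and q form
    their bisector plane, and every other point x of S cuts out in it the line
    of centres equidistant from p, q and x.  No three points being collinear
    and no four concyclic, these n - 2 lines are genuine and distinct; they are
    not all concurrent (S is not cospherical) nor all parallel (S is not
    coplanar).  The crossing points of exactly two of them are the centres of
    the four-point spheres through p and q.

    A planar arrangement of m distinct lines, not all concurrent and not all
    parallel, has at least m / 11 such simple crossings.  Indeed, let i be a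
    line without simple crossing and v a crossing nearest to i among those off
    i.  If no line through v is parallel to i, then v is simple: three lines
    through v would meet i in three points, and a further line through the
    middle one would cut one of the outer two closer to i.  If a line l through
    v is parallel to i, no two lines cross between i and l, which makes an
    extreme crossing of l simple, and it is as near to i as v.  Conversely a
    simple crossing lies on two lines, and is nearest to at most nine: such a
    line i is determined by the side of the crossing on which it cuts each of
    the two lines, or by being parallel to it.

    Summing over the ordered pairs (p, q) counts every four-point sphere twelve
    times, whence n (n - 1) (n - 2) <= 132 N, that is, 'C(n, 3) <= 22 N. *)
Require Import Defs.
From mathcomp Require Import all_boot all_order all_algebra finmap.
From mathcomp Require Import all_classical all_reals.
From mathcomp Require Import ring lra zify.

Set Implicit Arguments.
Unset Strict Implicit.
Unset Printing Implicit Defensive.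

Import Order.TTheory GRing.Theory Num.Theory.

Local Open Scope ring_scope.

(** * Arrangements of lines in the plane *)

Section Arrangement.
Variables (R : realFieldType) (I : finType) (a b c : I -> R).

Definition ev i (x y : R) := a i * x + b i * y + c i.

Definition det i j := a i * b j - a j * b i.

(* Cramer's rule; meaningful only if [det i j != 0]. *)
Definition meet_x i j := (b i * c j - b j * c i) / det i j.
Definition meet_y i j := (c i * a j - c j * a i) / det i j.

(* Up to scale, the abscissa along the direction of the line [i]. *)
Definition pos i (x y : R) := a i * y - b i * x.

(** The absolute value of [ev i] is the distance to the line [i] up to a factor depending on [i]
    alone; this is harmless, as only distances to the same line are compared. *)
Definition nearest i (x y : R) :=
  ev i x y != 0 /\ forall j k x' y', j != k -> ev j x' y' = 0 ->
    ev k x' y' = 0 -> ev i x' y' != 0 -> `|ev i x y| <= `|ev i x' y'|.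

(** A simple crossing is recorded as the set of the two lines through it, so that counting takes
    place in a finite type. *)
Definition ordinary_pairs : {set {set I}} :=
  [set e : {set I} | (#|e| == 2) && `[< exists x y,
    forall i, (ev i x y == 0) = (i \in e) >]].

Hypothesis line_neq0 : forall i, (a i != 0) || (b i != 0).
Hypothesis meet_uniq : forall i j x y x' y', i != j ->
  ev i x y = 0 -> ev j x y = 0 -> ev i x' y' = 0 -> ev j x' y' = 0 ->
  x = x' /\ y = y'.
Hypothesis not_concurrent : forall x y, exists i, ev i x y != 0.
Hypothesis not_parallel : exists i j, det i j != 0.

Lemma norm2_gt0 i : 0 < a i ^+ 2 + b i ^+ 2.
Proof.
have := line_neq0 i.
rewrite lt0r addr_ge0 ?sqr_ge0 // andbT paddr_eq0 ?sqr_ge0 // !sqrf_eq0.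
by rewrite negb_and.
Qed.

Lemma detC i j : det i j = - det j i.
Proof. by rewrite /det; ring. Qed.

Lemma det_neq0C i j : (det i j != 0) = (det j i != 0).
Proof. by rewrite detC oppr_eq0. Qed.

Lemma meetP i j : det i j != 0 ->
  ev i (meet_x i j) (meet_y i j) = 0 /\ ev j (meet_x i j) (meet_y i j) = 0.
Proof.
by rewrite /ev /meet_x /meet_y /det => h; split; field.
Qed.

(** Moving a common point by the direction [(- b i, a i)] would give a second common point, which
    [meet_uniq] forbids for distinct lines. *)
Lemma parallel_eq i j x y :
  det i j = 0 -> ev i x y = 0 -> ev j x y = 0 -> i = j.
Proof.
move=> dij ix jx; apply/eqP/negPn/negP => nij.
have [] := @meet_uniq i j x y (x - b i) (y + a i) nij ix jx.
- by rewrite /ev in ix *; rewrite -{}ix; ring.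
- have -> : ev j (x - b i) (y + a i) = ev j x y + det i j by rewrite /ev/det; ring.
  by rewrite jx dij addr0.
move=> /eqP; rewrite -subr_eq0 opprB addrC addrNK => /eqP bi.
move=> /eqP; rewrite -subr_eq0 opprD addNKr oppr_eq0 => /eqP ai.
by have := line_neq0 i; rewrite ai bi eqxx.
Qed.

Lemma det_meet i j x y : i != j -> ev i x y = 0 -> ev j x y = 0 -> det i j != 0.
Proof. by move=> nij ix jx; apply: contra_neq nij => /parallel_eq; apply; eassumption. Qed.

Lemma ev_neq i j x y : ev i x y != 0 -> ev j x y = 0 -> i != j.
Proof. by move=> ix jx; apply: contraNneq ix => ->; rewrite jx. Qed.

Lemma det_neq0_neq i j : det i j != 0 -> i != j.
Proof. by apply: contraNneq => ->; rewrite /det subrr. Qed.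

Lemma parallel_trans i j k : det i j = 0 -> det i k = 0 -> det j k = 0.
Proof.
move=> ij ik; have n0 := lt0r_neq0 (norm2_gt0 i).
apply: (mulfI n0); rewrite mulr0.
have -> : (a i ^+ 2 + b i ^+ 2) * det j k =
  (a i * a j + b i * b j) * det i k - (a i * a k + b i * b k) * det i j.
  by rewrite /det; ring.
by rewrite ij ik !mulr0 subrr.
Qed.

(** A displacement that keeps [ev i] constant is a multiple of [(- b i, a i)]; along it [ev m] is
    affine in [pos i], with slope proportional to [det i m]. *)
Lemma pos_diff i m x y x' y' : ev i x y = ev i x' y' ->
  (a i ^+ 2 + b i ^+ 2) * (ev m x y - ev m x' y') =
  det i m * (pos i x y - pos i x' y').
Proof.
move=> /eqP; rewrite -subr_eq0 => /eqP e.
have -> : (a i ^+ 2 + b i ^+ 2) * (ev m x y - ev m x' y') =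
  det i m * (pos i x y - pos i x' y') +
  (a i * a m + b i * b m) * (ev i x y - ev i x' y').
  by rewrite /ev /det /pos; ring.
by rewrite e mulr0 addr0.
Qed.

Lemma parallel_ev_eq i l x y x' y' : det l i = 0 ->
  ev l x y = 0 -> ev l x' y' = 0 -> ev i x y = ev i x' y'.
Proof.
move=> d e e'; apply/eqP; rewrite -subr_eq0.
have := @pos_diff l i x y x' y' (etrans e (esym e')).
rewrite d mul0r => /eqP; rewrite mulf_eq0 => /orP[|//].
by rewrite (negPf (lt0r_neq0 (norm2_gt0 l))).
Qed.

(** The two points bound a segment of [j] that ends on [i]. A sign change of [ev m] would make [m]
    cross [j] strictly inside it, hence closer to [i] but still off [i]. *)
Lemma no_crossing i j m x y x' y' : nearest i x y ->
  ev j x y = 0 -> ev j x' y' = 0 -> ev i x' y' = 0 ->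
  0 <= ev m x y * ev m x' y'.
Proof.
move=> [iz nr] jz jz' iz'; rewrite leNgt; apply/negP => neg.
have mz : ev m x y != 0 by apply: contraTneq neg => ->; rewrite mul0r ltxx.
have d0 : ev m x y - ev m x' y' != 0 by apply/eqP => e; nra.
(* The parameter at which [ev m] vanishes on the segment; there [ev i] is its initial value scaled
   by [1 - t]. *)
set t := ev m x y / (ev m x y - ev m x' y').
have t01 : 0 < t < 1.
  have [mp|mn] := ltP 0 (ev m x y).
    have m' : ev m x' y' < 0 by nra.
    by rewrite /t divr_gt0 ?ltr_pdivrMr; lra.
  have m' : 0 < ev m x' y' by nra.
  have mn' : ev m x y < 0 by rewrite lt_neqAle mz.
  by rewrite /t -[_ / _]mulrNN -invrN divr_gt0 ?ltr_pdivrMr; lra.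
have evt k : ev k (x + t * (x' - x)) (y + t * (y' - y)) =
    (1 - t) * ev k x y + t * ev k x' y' by rewrite /ev; ring.
have := nr j m (x + t * (x' - x)) (y + t * (y' - y)).
rewrite !evt jz jz' iz' !mulr0 !addr0.
have nz : (1 - t) * ev i x y != 0 by rewrite mulf_neq0 //; apply/eqP; lra.
rewrite eq_sym (ev_neq mz jz) => /(_ isT erefl) h.
suff /h /(_ nz) : (1 - t) * ev m x y + t * ev m x' y' = 0.
  rewrite normrM (@ger0_norm _ (1 - t)); last lra.
  have : 0 < `|ev i x y| by rewrite normr_gt0.
  by move: (`|_|) => u u0; nra.
by rewrite /t; field.
Qed.

(** * Lines without simple crossing *)

Section NoOrdinary.
Variable i : I.
(* No crossing on the line [i] is simple. *)
Hypothesis third : forall j x y, j != i -> ev i x y = 0 -> ev j x y = 0 ->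
  exists k, [/\ k != i, k != j & ev k x y = 0].

Lemma ex_transversal : exists j, det i j != 0.
Proof.
have [j [k jk]] := not_parallel.
have [ij|ij] := eqVneq (det i j) 0; last by exists j.
have [ik|ik] := eqVneq (det i k) 0; last by exists k.
by rewrite (parallel_trans ij ik) eqxx in jk.
Qed.

(** Through a crossing of [i] and [j] passes a third line [k], and some [l] misses this point. As
    [j] and [k] are not parallel, [l] meets one of them, necessarily off [i]. *)
Lemma ex_vertex_off : exists j k, det j k != 0 /\ ev i (meet_x j k) (meet_y j k) != 0.
Proof.
have [j ij] := ex_transversal.
have [iA jA] := meetP ij; move: iA jA.
move: (meet_x i j) (meet_y i j) => x y iA jA.
have ji : j != i by rewrite eq_sym det_neq0_neq.
have [k [ki kj kA]] := third ji iA jA.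
have [l lA] := not_concurrent x y.
suff [m [mi mA lm]] : exists m, [/\ m != i, ev m x y = 0 & det l m != 0].
  exists l, m; split => //; apply: contraNneq lA => iP.
  have [lP mP] := meetP lm.
  by have [-> ->] := meet_uniq mi mA iA mP iP; rewrite lP.
have [lj|lj] := eqVneq (det l j) 0; last by exists j.
exists k; split => //; apply/eqP => lk.
by have := det_meet kj kA jA; rewrite detC (parallel_trans lj lk) oppr0 eqxx.
Qed.

Lemma ex_nearest : exists j k x y,
  [/\ j != k, ev j x y = 0, ev k x y = 0 & nearest i x y].
Proof.
have [j0 [k0 [jk0 ijk0]]] := ex_vertex_off.
(* Minimizing over pairs of lines instead of points keeps the search finite. *)
pose P (p : I * I) := (det p.1 p.2 != 0) && (ev i (meet_x p.1 p.2) (meet_y p.1 p.2) != 0).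
pose F (p : I * I) := `|ev i (meet_x p.1 p.2) (meet_y p.1 p.2)|.
have P0 : P (j0, k0) by rewrite /P jk0.
case: (Order.TotalTheory.arg_minP F P0) => -[j k] /andP[/= jk ijk] hmin.
have [jz kz] := meetP jk.
exists j, k, (meet_x j k), (meet_y j k); split => //; first exact: det_neq0_neq.
split=> // j' k' x' y' njk j'z k'z iz.
have d := det_meet njk j'z k'z; have [h1 h2] := meetP d.
have [ex ey] := meet_uniq njk h1 h2 j'z k'z.
have := hmin (j', k'); rewrite /P /F /= ex ey; apply.
by rewrite d.
Qed.

Lemma no_three_transversals x y j k l :
  nearest i x y -> ev j x y = 0 -> ev k x y = 0 -> ev l x y = 0 ->
  j != k -> k != l -> j != l ->
  det i j != 0 -> det i k != 0 -> det i l != 0 -> False.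
Proof.
move=> near.
have iz := proj1 near.
have uniqpos j' k' : ev j' x y = 0 -> ev k' x y = 0 -> j' != k' ->
    det i j' != 0 -> det i k' != 0 ->
    pos i (meet_x i j') (meet_y i j') != pos i (meet_x i k') (meet_y i k').
  move=> jz kz jk ij ik; apply: contraNneq iz => e.
  have [iA jA] := meetP ij; have [iB kB] := meetP ik.
  have := @pos_diff i j' _ _ _ _ (etrans iA (esym iB)).
  rewrite e subrr mulr0 jA sub0r => /eqP; rewrite mulf_eq0 oppr_eq0.
  rewrite (negPf (lt0r_neq0 (norm2_gt0 i))) /= => /eqP jB.
  by have [-> ->] := meet_uniq jk jz kz jB kB; rewrite iB.
(* The three lines meet [i] at A, B and C, with C between A and B. The third line [m] through C
   separates A from B, yet [no_crossing] puts both on the side of [(x, y)]. *)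
have middle j' k' l' : ev j' x y = 0 -> ev k' x y = 0 -> ev l' x y = 0 ->
    det i j' != 0 -> det i k' != 0 -> det i l' != 0 ->
    pos i (meet_x i j') (meet_y i j') < pos i (meet_x i l') (meet_y i l') ->
    pos i (meet_x i l') (meet_y i l') < pos i (meet_x i k') (meet_y i k') -> False.
  move=> jz kz lz ij ik il.
  have [iA jA] := meetP ij; have [iB kB] := meetP ik; have [iC lC] := meetP il.
  move: iA jA iB kB iC lC.
  move: (meet_x i j') (meet_y i j') (meet_x i k') (meet_y i k') => xA yA xB yB.
  move: (meet_x i l') (meet_y i l') => xC yC iA jA iB kB iC lC lt1 lt2.
  have li : l' != i by rewrite eq_sym det_neq0_neq.
  have [m [mi ml mC]] := third li iC lC.
  have mz : ev m x y != 0.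
    apply: contraNneq iz => mz.
    by have [-> ->] := meet_uniq ml mz lz mC lC; rewrite iC.
  have hA := no_crossing m near jz jA iA.
  have hB := no_crossing m near kz kB iB.
  have dim : det i m != 0 by apply: det_meet iC mC; rewrite eq_sym.
  have n0 := norm2_gt0 i.
  have eA := @pos_diff i m _ _ _ _ (etrans iA (esym iC)).
  have eB := @pos_diff i m _ _ _ _ (etrans iB (esym iC)).
  rewrite mC !subr0 in eA eB.
  have prod : 0 <= ev m xA yA * ev m xB yB.
    have : 0 < ev m x y ^+ 2 by rewrite lt0r sqr_ge0 andbT sqrf_eq0.
    nra.
  have d2 : 0 < det i m ^+ 2 by rewrite lt0r sqr_ge0 andbT sqrf_eq0.
  have : 0 <= (det i m * (pos i xA yA - pos i xC yC)) * (det i m * (pos i xB yB - pos i xC yC)).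
    by rewrite -eA -eB mulrACA mulr_ge0 // mulr_ge0 // ltW.
  have -> : (det i m * (pos i xA yA - pos i xC yC)) * (det i m * (pos i xB yB - pos i xC yC)) =
    - (det i m ^+ 2 * ((pos i xC yC - pos i xA yA) * (pos i xB yB - pos i xC yC))) by ring.
  by rewrite oppr_ge0 leNgt mulr_gt0 // mulr_gt0 // subr_gt0.
move=> jz kz lz jk kl jl ij ik il.
have njk := uniqpos _ _ jz kz jk ij ik.
have nkl := uniqpos _ _ kz lz kl ik il.
have njl := uniqpos _ _ jz lz jl ij il.
have M1 := middle _ _ _ jz kz lz ij ik il.
have M2 := middle _ _ _ kz jz lz ik ij il.
have M3 := middle _ _ _ jz lz kz ij il ik.
have M4 := middle _ _ _ lz jz kz il ij ik.
have M5 := middle _ _ _ kz lz jz ik il ij.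
have M6 := middle _ _ _ lz kz jz il ik ij.
case: (ltgtP (pos i (meet_x i j) (meet_y i j)) (pos i (meet_x i k) (meet_y i k))) njk => // h1 _;
case: (ltgtP (pos i (meet_x i k) (meet_y i k)) (pos i (meet_x i l) (meet_y i l))) nkl => // h2 _;
case: (ltgtP (pos i (meet_x i j) (meet_y i j)) (pos i (meet_x i l) (meet_y i l))) njl => // h3 _; auto.
Qed.

Lemma nearest_ordinary_parallel x y l : nearest i x y -> ev l x y = 0 -> det i l = 0 ->
  exists j x' y', [/\ nearest i x' y', j != l, ev j x' y' = 0, ev l x' y' = 0 &
    forall k, ev k x' y' = 0 -> k = j \/ k = l].
Proof.
move=> near lz il.
have il' : det l i = 0 by rewrite detC il oppr0.
(* [j0] crosses [i] as far to the left as possible and, among such lines,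
   also crosses [l] as far to the left as possible. *)
pose A j := (meet_x i j, meet_y i j); pose Q j := (meet_x l j, meet_y l j).
pose s j := pos i (A j).1 (A j).2; pose t j := pos i (Q j).1 (Q j).2.
have [j2 ij2] := ex_transversal.
case: (@Order.TotalTheory.arg_minP _ _ _ j2 (fun j => det i j != 0) s ij2) => j1 ij1 smin.
have P1 : (det i j1 != 0) && (s j1 == s j1) by rewrite ij1 eqxx.
case: (@Order.TotalTheory.arg_minP _ _ _ j1 (fun j => (det i j != 0) && (s j == s j1)) t P1)
  => j0 /andP[ij0 /eqP sj0] tmin.
have trans j : det i j != 0 -> det l j != 0.
  by apply: contra_neq => lj; exact: parallel_trans il' lj.
have [iA0 jA0] := meetP ij0.
have [lQ0 jQ0] := meetP (trans _ ij0).
have nearQ x' y' : ev l x' y' = 0 -> nearest i x' y'.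
  by move=> lz'; rewrite /nearest (parallel_ev_eq il' lz' lz).
have j0i : j0 != i by rewrite eq_sym det_neq0_neq.
have j0l : j0 != l by rewrite eq_sym det_neq0_neq // trans.
exists j0, (meet_x l j0), (meet_y l j0); split => //; first exact: nearQ.
move=> k kQ.
have [->|kl] := eqVneq k l; first by right.
have [->|kj0] := eqVneq k j0; first by left.
exfalso.
have lk : det l k != 0 by apply: det_meet lQ0 kQ; rewrite eq_sym.
have ik : det i k != 0 by apply: contra_neq lk => ik; exact: parallel_trans il ik.
(* The line [m] meets [i] where [j0] does, and [l] strictly to the right of [j0]; the line [k] meets
   [l] where [j0] does, and [i] strictly to the right of [j0]. So [k] and [m] cross between [i] and
   [l], against [no_crossing]. *)
have [m [mi mj0 mA0]] := third j0i iA0 jA0.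
have im : det i m != 0 by apply: det_meet iA0 mA0; rewrite eq_sym.
have [iAm mAm] := meetP im.
have [exm eym] : meet_x i m = meet_x i j0 /\ meet_y i m = meet_y i j0.
  by apply: (meet_uniq mi mAm iAm mA0 iA0).
have sm : s m = s j0 by rewrite /s /A exm eym.
have [lQm mQm] := meetP (trans _ im).
have [lQk kQk] := meetP lk.
have [exk eyk] : meet_x l k = meet_x l j0 /\ meet_y l k = meet_y l j0.
  by apply: (meet_uniq kl kQk lQk kQ lQ0).
have tk : t k = t j0 by rewrite /t /Q exk eyk.
have [iAk kAk] := meetP ik.
have n0 := norm2_gt0 i.
have eqpos k' x1 y1 x2 y2 : ev i x1 y1 = ev i x2 y2 -> ev k' x2 y2 = 0 ->
    pos i x1 y1 = pos i x2 y2 -> ev k' x1 y1 = 0.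
  move=> ei e2 ep; have := @pos_diff i k' _ _ _ _ ei.
  rewrite ep subrr mulr0 e2 subr0 => /eqP; rewrite mulf_eq0 (negPf (lt0r_neq0 n0)) /=.
  by move/eqP.
have Qne : ev i (meet_x l j0) (meet_y l j0) != 0 by have [] := nearQ _ _ lQ0.
have tm : t j0 < t m.
  rewrite lt_neqAle tmin ?im ?sm ?sj0 ?eqxx // andbT.
  apply: contraNneq Qne => te.
  have mQ0 : ev m (meet_x l j0) (meet_y l j0) = 0.
    by apply: (eqpos m _ _ _ _ _ mQm te); rewrite (parallel_ev_eq il' lQ0 lQm).
  by have [-> ->] := meet_uniq mj0 mQ0 jQ0 mA0 jA0; rewrite iA0.
have sk : s j0 < s k.
  rewrite lt_neqAle; apply/andP; split; last by rewrite sj0 smin.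
  apply: contraNneq Qne => se.
  have kA0 : ev k (meet_x i j0) (meet_y i j0) = 0.
    by apply: (eqpos k _ _ _ _ _ kAk se); rewrite iA0 iAk.
  by have [-> ->] := meet_uniq kj0 kQ jQ0 kA0 jA0; rewrite iA0.
have := no_crossing k (nearQ _ _ lQm) mQm mAm iAm.
have e1 := @pos_diff i k _ _ _ _ (parallel_ev_eq il' lQm lQk).
have e2 := @pos_diff i k _ _ _ _ (etrans iAm (esym iAk)).
rewrite kQk kAk !subr0 in e1 e2.
rewrite -(pmulr_rge0 _ (mulr_gt0 n0 n0)) mulrACA e1 e2.
have -> : det i k * (t m - t k) * (det i k * (s m - s k)) =
  - (det i k ^+ 2 * ((t m - t k) * (s k - s m))) by ring.
have d2 : 0 < det i k ^+ 2 by rewrite lt0r sqr_ge0 andbT sqrf_eq0.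
by rewrite oppr_ge0 leNgt mulr_gt0 // mulr_gt0 // subr_gt0 ?tk ?sm.
Qed.

Lemma nearest_ordinary : exists j k x y, [/\ nearest i x y, j != k,
  ev j x y = 0, ev k x y = 0 & forall l, ev l x y = 0 -> l = j \/ l = k].
Proof.
have [j [k [x [y [jk jz kz near]]]]] := ex_nearest.
have [[l [lz il]]|nopar] := pselect (exists l, ev l x y = 0 /\ det i l = 0).
  have [j' [x' [y' [near' jl' jz' lz' u]]]] := nearest_ordinary_parallel near lz il.
  by exists j', l, x', y'.
exists j, k, x, y; split => // l lz.
have np l' : ev l' x y = 0 -> det i l' != 0.
  by move=> l'z; apply/eqP => d; apply: nopar; exists l'.
have [->|lj] := eqVneq l j; first by left.
have [->|lk] := eqVneq l k; first by right.
exfalso; apply: (no_three_transversals near jz kz lz jk _ _ (np _ jz) (np _ kz) (np _ lz)).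
  by rewrite eq_sym.
by rewrite eq_sym.
Qed.

End NoOrdinary.

(** * Charging each line to a simple crossing *)

Definition side i j k : option bool :=
  if det i j == 0 then None else Some (0 < ev k (meet_x i j) (meet_y i j)).

(** Let [i] and [i'] cut [j] at A and A', and measure positions on [j] by [ev k], which vanishes at
    [(x, y)]. If A' is off [i], nearness makes A at most as far from [(x, y)] as from A'; likewise
    with the roles exchanged. Two distinct points on the same side of [(x, y)] cannot satisfy
    both. *)
Lemma side_inj i i' j k x y : nearest i x y -> nearest i' x y ->
  j != k -> ev j x y = 0 -> ev k x y = 0 ->
  det i j != 0 -> side i j k = side i' j k ->
  meet_x i j = meet_x i' j /\ meet_y i j = meet_y i' j.
Proof.
move=> near near' jk jz kz ij.
rewrite /side (negPf ij); case: eqVneq => // i'j [sg].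
have [iA jA] := meetP ij; have [iA' jA'] := meetP i'j.
move: iA jA iA' jA' sg.
move: (meet_x i j) (meet_y i j) (meet_x i' j) (meet_y i' j) => X Y X' Y' iA jA iA' jA' sg.
have [iz nr] := near; have [iz' nr'] := near'.
have kA : ev k X Y != 0.
  by apply: contraNneq iz => kA; have [-> ->] := meet_uniq jk jz kz jA kA; rewrite iA.
have kA' : ev k X' Y' != 0.
  by apply: contraNneq iz' => kA'; have [-> ->] := meet_uniq jk jz kz jA' kA'; rewrite iA'.
suff e : ev k X Y = ev k X' Y'.
  have n0 := norm2_gt0 j.
  have := @pos_diff j k X Y X' Y' (etrans jA (esym jA')).
  rewrite e subrr mulr0 => /esym/eqP; rewrite mulf_eq0 (negPf (det_meet jk jz kz)) /= => pe.
  have := @pos_diff j i X Y X' Y' (etrans jA (esym jA')).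
  rewrite (eqP pe) mulr0 iA sub0r => /eqP; rewrite mulf_eq0 (negPf (lt0r_neq0 n0)) oppr_eq0 /=.
  by move/eqP => iA2; apply: meet_uniq (det_neq0_neq ij) iA jA iA2 jA'.
(* Interpolation of the affine function [ev u] on the line [j], with [ev k] as coordinate. *)
have lin u : ev u x y * (ev k X' Y' - ev k X Y) =
    ev u X Y * ev k X' Y' - ev u X' Y' * ev k X Y.
  have n0 := norm2_gt0 j.
  have e1 := @pos_diff j k X Y x y (etrans jA (esym jz)).
  have e2 := @pos_diff j k X' Y' x y (etrans jA' (esym jz)).
  have e3 := @pos_diff j u X Y x y (etrans jA (esym jz)).
  have e4 := @pos_diff j u X' Y' x y (etrans jA' (esym jz)).
  rewrite kz !subr0 in e1 e2.
  apply: (mulfI (lt0r_neq0 (mulr_gt0 n0 n0))).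
  apply/eqP; rewrite -subr_eq0; apply/eqP.
  set N := (a j ^+ 2 + b j ^+ 2) in e1 e2 e3 e4 *.
  have -> : N * N * (ev u x y * (ev k X' Y' - ev k X Y)) -
    N * N * (ev u X Y * ev k X' Y' - ev u X' Y' * ev k X Y) =
    (N * ev k X Y) * (N * (ev u X' Y' - ev u x y)) -
    (N * ev k X' Y') * (N * (ev u X Y - ev u x y)) by ring.
  by rewrite e1 e2 e3 e4; ring.
have Li := lin i; rewrite iA mul0r sub0r in Li.
have Li' := lin i'; rewrite iA' mul0r subr0 in Li'.
have step u U V W : U * (V - W) = - u * W -> U != 0 -> W != 0 -> V != 0 ->
    (0 < W) = (0 < V) -> (u != 0 -> `|U| <= `|u|) -> u = 0 \/ `|W| <= `|V - W| :> R.
  move=> e U0 W0 V0 _ h; have [->|u0] := eqVneq u 0; [by left|right].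
  have := congr1 Num.norm e; rewrite !normrM normrN => e'.
  have := h u0; have : 0 < `|U| by rewrite normr_gt0.
  have : 0 < `|W| by rewrite normr_gt0.
  move: e'; move: (`|U|) (`|W|) (`|V - W|) (`|u|) => p q r w; nra.
have ij' := ev_neq iz jz; have i'j' := ev_neq iz' jz.
have S1 := step _ _ _ _ (etrans Li (esym (mulNr _ _))) iz kA kA' sg (nr i' j _ _ i'j' iA' jA').
have S2 : ev i' X Y = 0 \/ `|ev k X' Y'| <= `|ev k X Y - ev k X' Y'|.
  apply: (step _ (ev i' x y) _ _ _ iz' kA' kA (esym sg) (nr' i j _ _ ij' iA jA)).
  by rewrite -[ev k X Y - _]opprB mulrN Li' mulNr.
have z1 : ev i X' Y' = 0 -> ev k X Y = ev k X' Y'.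
  move=> e; move: Li; rewrite e mul0r oppr0 => /eqP; rewrite mulf_eq0 (negPf iz) /= subr_eq0.
  by move/eqP.
have z2 : ev i' X Y = 0 -> ev k X Y = ev k X' Y'.
  move=> e; move: Li'; rewrite e mul0r => /eqP; rewrite mulf_eq0 (negPf iz') /= subr_eq0.
  by move/eqP.
case: S1 => [/z1//|S1]; case: S2 => [/z2//|S2].
move: sg S1 S2; rewrite distrC.
have [p|p] := ltP 0 (ev k X Y).
  move=> /esym p'; rewrite (gtr0_norm p) (gtr0_norm p').
  by case: (ger0P (ev k X Y - ev k X' Y')); lra.
move=> /esym/negbT; rewrite -leNgt => p'.
have {}p : ev k X Y < 0 by rewrite lt_neqAle kA.
have {}p' : ev k X' Y' < 0 by rewrite lt_neqAle kA'.
rewrite (ltr0_norm p) (ltr0_norm p').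
by case: (ger0P (ev k X Y - ev k X' Y')); lra.
Qed.

(** By [side_inj] the lines [i] and [i'] share their points on [j] and on [k]. If these points
    differ, the lines coincide; if they agree, both are [(x, y)], which is off [i]. A line parallel
    to [j] or [k] is fixed by its one point on the other. *)
Lemma sides_inj i i' j k x y : nearest i x y -> nearest i' x y ->
  j != k -> ev j x y = 0 -> ev k x y = 0 ->
  side i j k = side i' j k -> side i k j = side i' k j -> i = i'.
Proof.
move=> near near' jk jz kz s1 s2.
have djk := det_meet jk jz kz.
have iz := proj1 near.
wlog ij : j k jk jz kz s1 s2 djk / det i j != 0.
  move=> W; have [ij|ij] := eqVneq (det i j) 0; last exact: (W j k).
  have kj : k != j by rewrite eq_sym.
  have dkj : det k j != 0 by rewrite det_neq0C.
  apply: (W k j kj kz jz s2 s1 dkj).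
  by apply: contra_neq djk => ik; exact: parallel_trans ij ik.
have i'j : det i' j != 0 by move: s1; rewrite /side (negPf ij); case: eqP.
have [ex ey] := side_inj near near' jk jz kz ij s1.
have [iA jA] := meetP ij; have [iA' jA'] := meetP i'j.
rewrite -ex -ey in iA' jA'.
have [ik|ik] := eqVneq (det i k) 0.
  have i'k : det i' k = 0 by apply/eqP; move: s2; rewrite /side ik eqxx; case: eqP.
  apply: parallel_eq iA iA'; apply: (@parallel_trans k).
    by rewrite detC ik oppr0.
  by rewrite detC i'k oppr0.
have i'k : det i' k != 0 by move: s2; rewrite /side (negPf ik); case: eqP.
have kj : k != j by rewrite eq_sym.
have [ex' ey'] := side_inj near near' kj kz jz ik s2.
have [iB kB] := meetP ik; have [iB' kB'] := meetP i'k.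
rewrite -ex' -ey' in iB' kB'.
apply/eqP/negPn/negP => ii.
have [e1 e2] := meet_uniq ii iA iA' iB iB'.
move: iz; rewrite -e1 -e2 in kB.
by have [-> ->] := meet_uniq jk jz kz jA kB; rewrite iA eqxx.
Qed.

Definition charged (e : {set I}) : {set I} :=
  [set i | `[< exists x y, (forall l, (ev l x y == 0) = (l \in e)) /\
                          (ev i x y = 0 \/ nearest i x y) >]].

Lemma card_charged e : e \in ordinary_pairs -> (#|charged e| <= 11)%N.
Proof.
rewrite inE => /andP[/cards2P[j [k [jk ->]]] /asboolP[x [y he]]].
have jz : ev j x y = 0 by apply/eqP; rewrite he !inE eqxx.
have kz : ev k x y = 0 by apply/eqP; rewrite he !inE eqxx orbT.
pose N : {set I} := [set i | `[< nearest i x y >]].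
have sub : charged [set j; k] \subset [set j; k] :|: N.
  apply/fintype.subsetP => i; rewrite finset.in_setU [i \in charged _]inE.
  move=> /asboolP[x' [y' [he' h]]].
  have jz' : ev j x' y' = 0 by apply/eqP; rewrite he' !inE eqxx.
  have kz' : ev k x' y' = 0 by apply/eqP; rewrite he' !inE eqxx orbT.
  have [ex ey] := meet_uniq jk jz' kz' jz kz; rewrite ex ey in h.
  case: h => [iz|near]; first by rewrite -he iz eqxx.
  by rewrite [i \in N]inE; apply/orP; right; apply/asboolP.
apply: leq_trans (subset_leq_card sub) _.
apply: leq_trans (leq_card_setU _ _) _.
rewrite cards2 jk.
have inj : {in N &, injective (fun i => (side i j k, side i k j))}.
  move=> i i'; rewrite !inE => n1 n2 [s1 s2].
  exact: sides_inj n1 n2 jk jz kz s1 s2.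
(* Two lines pass through the crossing, and a pair of sides takes 3 * 3 = 9 values. *)
rewrite -(card_in_imset inj) (leq_add2l 2 _ 9).
by apply: leq_trans (max_card _) _; rewrite card_prod !card_option card_bool.
Qed.

(** If no simple crossing lies on [i], each crossing on [i] has a third line, which is the
    assumption behind [nearest_ordinary]. *)
Lemma in_charged i : exists2 e, e \in ordinary_pairs & i \in charged e.
Proof.
have [[e he ie]|no] := pselect (exists2 e, e \in ordinary_pairs & i \in e).
  exists e => //; move: he; rewrite inE => /andP[_ /asboolP[x [y h]]].
  rewrite inE; apply/asboolP; exists x, y; split => //; left.
  by apply/eqP; rewrite h.
have third j x y : j != i -> ev i x y = 0 -> ev j x y = 0 ->
    exists k, [/\ k != i, k != j & ev k x y = 0].
  move=> ji iz jz; apply: contrapT => nk; apply: no; exists [set i; j]; last by rewrite !inE eqxx.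
  rewrite inE cards2 (eq_sym i) ji /=; apply/asboolP; exists x, y => l.
  rewrite !inE; apply/eqP/orP => [lz|[/eqP->|/eqP->]//].
  case: (eqVneq l i) => [_|li]; first by left.
  case: (eqVneq l j) => [_|lj]; first by right.
  by exfalso; apply: nk; exists l.
have [j [k [x [y [near jk jz kz u]]]]] := nearest_ordinary third.
have he l : (ev l x y == 0) = (l \in [set j; k]).
  rewrite !inE; apply/eqP/orP => [/u[->|->]|[/eqP->|/eqP->]//]; first by left.
  by right.
exists [set j; k].
  by rewrite inE cards2 jk /=; apply/asboolP; exists x, y.
by rewrite inE; apply/asboolP; exists x, y; split => //; right.
Qed.

Lemma card_ordinary_pairs : (#|I| <= 11 * #|ordinary_pairs|)%N.
Proof.
rewrite -cardsT.
have sub : [set: I] \subset \bigcup_(e in ordinary_pairs) charged e.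
  apply/fintype.subsetP => i _; have [e he ie] := in_charged i.
  by apply/bigcupP; exists e.
apply: leq_trans (subset_leq_card sub) _.
apply: leq_trans (_ : (\sum_(e in ordinary_pairs) #|charged e| <= _)%N).
  elim/big_rec2: _ => [|e m A _ le]; first by rewrite cards0.
  apply: leq_trans (leq_card_setU _ _) _; exact: leq_add.
by rewrite mulnC -sum_nat_const leq_sum // => e; exact: card_charged.
Qed.

End Arrangement.

(** * Spheres, circles and their traces on the point set *)

Section Spheres.
Variable R : realType.
Implicit Types (x y c p q : 'rV[R]_3) (A : set 'rV[R]_3) (S T : {fset 'rV[R]_3}).

Lemma sum3 (F : 'I_3 -> R) : \sum_(i < 3) F i = F 0 + F 1 + F 2.
Proof.
rewrite !big_ord_recl big_ord0 addr0 addrA.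
by congr (F _ + F _ + F _); apply: val_inj.
Qed.

Lemma row3P x y : x 0 0 = y 0 0 -> x 0 1 = y 0 1 -> x 0 2 = y 0 2 -> x = y.
Proof.
move=> e0 e1 e2; apply/rowP => -[[|[|[|//]]] lt].
- by rewrite (_ : Ordinal lt = 0) //; apply: val_inj.
- by rewrite (_ : Ordinal lt = 1) //; apply: val_inj.
- by rewrite (_ : Ordinal lt = 2) //; apply: val_inj.
Qed.

Definition row3 (u v w : R) : 'rV[R]_3 := \row_(i < 3) [:: u; v; w]`_i.

Lemma row3E u v w : (row3 u v w 0 0 = u) * (row3 u v w 0 1 = v) * (row3 u v w 0 2 = w).
Proof. by rewrite /row3 !mxE. Qed.

Definition sqd x c : R := \sum_(i < 3) (x 0 i - c 0 i) ^+ 2.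

Lemma sqdE x c : sqd x c =
  (x 0 0 - c 0 0) ^+ 2 + (x 0 1 - c 0 1) ^+ 2 + (x 0 2 - c 0 2) ^+ 2.
Proof. exact: sum3. Qed.

Lemma sqd_ge0 x c : 0 <= sqd x c.
Proof. by apply: sumr_ge0 => i _; exact: sqr_ge0. Qed.

Lemma sqd_eq0 x c : sqd x c = 0 -> x = c.
Proof.
move=> /eqP; rewrite psumr_eq0 => [/allP h|i _]; last exact: sqr_ge0.
apply/rowP => i; apply/eqP; rewrite -subr_eq0 -sqrf_eq0.
by apply: h; rewrite mem_index_enum.
Qed.

Lemma sphereP c r x : 0 < r -> sphere c r x <-> sqd x c = r ^+ 2.
Proof.
move=> r0; rewrite /sphere /edist /= -/(sqd x c); split => [<-|->].
  by rewrite sqr_sqrtr // sqd_ge0.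
by rewrite sqrtr_sqr gtr0_norm.
Qed.

(** Subtracting the two sphere equations leaves the equation of the radical plane, which cuts the
    first sphere in a circle. *)
Lemma two_spheres_concyclic T c1 c2 d1 d2 : c1 != c2 -> (1 < #|` T|)%N ->
  (forall s, s \in T -> sqd s c1 = d1 /\ sqd s c2 = d2) -> concyclic T.
Proof.
move=> c12 T2 hT.
have N0 : sqd c2 c1 != 0 by apply: contra_neq c12 => /sqd_eq0.
pose u := c2 - c1.
pose dot (v w : 'rV[R]_3) := \sum_(i < 3) v 0 i * w 0 i.
(* The radical plane is [dot u x = del], and [c] is the foot of the perpendicular from [c1] to
   it. *)
pose del := (dot c2 c2 - dot c1 c1 + d1 - d2) / 2.
pose t := (del - dot u c1) / sqd c2 c1.
pose c := c1 + t *: u.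
have tN : t * sqd c2 c1 = del - dot u c1 by rewrite /t divfK.
have us s : s \in T -> dot u s = del.
  move=> /hT[h1 h2]; rewrite /del -h1 -h2 /dot /u !sqdE !sum3 !mxE.
  by field.
have uc : dot u c = del.
  have -> : dot u c = dot u c1 + t * sqd c2 c1.
    by rewrite /dot /c /u sqdE !sum3 !mxE; ring.
  by rewrite tN addrCA subrr addr0.
have sc s : s \in T -> sqd s c = d1 - t ^+ 2 * sqd c2 c1.
  move=> sT; have [h1 _] := hT s sT.
  have -> : sqd s c = sqd s c1 - 2 * t * (dot u s - dot u c1) + t ^+ 2 * sqd c2 c1.
    by rewrite /dot /c /u !sqdE !sum3 !mxE; ring.
  by rewrite us // -tN h1; ring.
have T0 : T != fset0 by rewrite -cardfs_gt0; apply: ltn_trans T2.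
have [s1 s1T] := fset0Pn _ T0.
have : (T `\ s1)%fset != fset0 by rewrite -cardfs_gt0 -(ltn_add2l (s1 \in T)) -cardfsD1 s1T.
move=> /fset0Pn[s2]; rewrite !inE => /andP[s12 s2T].
(* A zero radius would identify the two distinct points [s1] and [s2]. *)
have r0 : 0 < d1 - t ^+ 2 * sqd c2 c1.
  rewrite lt0r -(sc _ s1T) sqd_ge0 andbT.
  apply: contra_neq s12 => e; rewrite (sqd_eq0 e); apply: sqd_eq0.
  by rewrite sc // -(sc _ s1T).
exists (plane u del `&` sphere c (Num.sqrt (d1 - t ^+ 2 * sqd c2 c1)))%classic; split.
  exists (plane u del), c, (Num.sqrt (d1 - t ^+ 2 * sqd c2 c1)); split => //.
    by exists u, del; split => //; rewrite subr_eq0 eq_sym.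
  by rewrite sqrtr_gt0.
move=> s /= sT; split; first exact: us.
by apply/sphereP; rewrite ?sqrtr_gt0 // sc // sqr_sqrtr // ltW.
Qed.

(** Distinct centres would make [T] concyclic; once the centres agree, one common point fixes the
    radius. *)
Lemma four_point_sphere_uniq T A B : #|` T| = 4%N ->
  ~ concyclic T -> is_sphere A -> is_sphere B ->
  (forall s, s \in T -> A s /\ B s) -> A = B.
Proof.
move=> T4 nc [c1 [r1 [r10 ->]]] [c2 [r2 [r20 ->]]] h.
have e : c1 = c2.
  apply/eqP/negPn/negP => c12; apply: nc.
  apply: (two_spheres_concyclic (d1 := r1 ^+ 2) (d2 := r2 ^+ 2) c12).
    by rewrite T4.
  by move=> s /h[/sphereP h1 /sphereP h2]; split; [apply: h1|apply: h2].
subst c2; have T0 : T != fset0 by rewrite -cardfs_gt0 T4.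
have [s /h[h1 h2]] := fset0Pn _ T0.
by move: h1 h2; rewrite /sphere /= => <- <-.
Qed.

(* The cross product of [e] and [f] is [k *: d]. *)
Lemma ex_frame (d : 'rV[R]_3) : d != 0 -> exists (e f : 'rV[R]_3) (k : R),
  [/\ k != 0, e 0 1 * f 0 2 - e 0 2 * f 0 1 = k * d 0 0,
      e 0 2 * f 0 0 - e 0 0 * f 0 2 = k * d 0 1 &
      e 0 0 * f 0 1 - e 0 1 * f 0 0 = k * d 0 2].
Proof.
move=> d0.
have [h0|h0] := eqVneq (d 0 0) 0; last first.
  exists (row3 (- d 0 1) (d 0 0) 0), (row3 (- d 0 2) 0 (d 0 0)), (d 0 0).
  by rewrite !row3E; split => //; ring.
have [h1|h1] := eqVneq (d 0 1) 0; last first.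
  exists (row3 0 (- d 0 2) (d 0 1)), (row3 (d 0 1) (- d 0 0) 0), (d 0 1).
  by rewrite !row3E; split => //; ring.
have [h2|h2] := eqVneq (d 0 2) 0; last first.
  exists (row3 (d 0 2) 0 (- d 0 0)), (row3 0 (d 0 2) (- d 0 1)), (d 0 2).
  by rewrite !row3E; split => //; ring.
by case/eqP: d0; apply: row3P; rewrite ?h0 ?h1 ?h2 mxE.
Qed.

(** Spheres are handled through the subsets of [S] that they cut out, which form a finite type. *)
Definition trace S A : {set S} := [set s : S | `[< A (val s) >]].

Definition sphere_traces S : {set {set S}} :=
  [set e : {set S} | (#|e| == 4%N) && `[< exists A, is_sphere A /\ trace S A = e >]].

Lemma card_fset_val S (e : {set S}) : #|` [fset val s | s in e]%fset| = #|e|.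
Proof.
rewrite card_in_imfset /=; first by rewrite -cardE.
by move=> ? ? _ _; exact: val_inj.
Qed.

Lemma fset_val_sub S (e : {set S}) : ([fset val s | s in e] `<=` S)%fset.
Proof. by apply/fsubsetP => x /imfsetP[s /= _ ->]; exact: valP. Qed.

(** * Spheres through two given points *)

Section Pencil.
Variables (S : {fset 'rV[R]_3}) (p q : S).
Hypothesis pq : p != q.
Hypothesis S5 : (5 <= #|` S|)%N.
Hypothesis not_cospherical : ~ cospherical S.
Hypothesis not_coplanar : ~ coplanar S.
Hypothesis not_concyclic :
  forall T, (T `<=` S)%fset -> #|` T| = 4%N -> ~ concyclic T.
Hypothesis not_collinear :
  forall T, (T `<=` S)%fset -> #|` T| = 3%N -> ~ collinear T.

Let P := val p.
Let d : 'rV[R]_3 := val q - val p.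
Let I := {s : S | (s != p) && (s != q)}.
Let ix (i : I) : S := val i.
Let pt (i : I) : 'rV[R]_3 := val (ix i).

Let ix_inj : injective ix.
Proof. exact: val_inj. Qed.

Let d_neq0 : d != 0.
Proof. by rewrite /d subr_eq0 eq_sym (inj_eq val_inj). Qed.

Let dd := d 0 0 ^+ 2 + d 0 1 ^+ 2 + d 0 2 ^+ 2.

Let dd_neq0 : dd != 0.
Proof.
apply/eqP => dd0; have /eqP := pq; apply; apply/val_inj/esym; apply: sqd_eq0.
by rewrite -dd0 sqdE /dd /d !mxE.
Qed.

Let pt_neq i : (ix i != p) * (ix i != q).
Proof. by have /andP[-> ->] := valP i. Qed.

(** If the cross product of [d] and [w] vanishes, then [w] equals its projection [t *: d], and the
    three points are collinear. *)
Let wedge_neq0 i (w := pt i - P) :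
  d 0 1 * w 0 2 = d 0 2 * w 0 1 -> d 0 2 * w 0 0 = d 0 0 * w 0 2 ->
  d 0 0 * w 0 1 = d 0 1 * w 0 0 -> False.
Proof.
move=> h0 h1 h2; have [np nq] := pt_neq i.
pose e : {set S} := [set p; q; ix i].
apply: (not_collinear (fset_val_sub e)).
  rewrite card_fset_val /e -finset.setUA cardsU1 !inE negb_or pq eq_sym np.
  by rewrite cards2 eq_sym nq.
exists (line P d); split; first by exists P, d.
pose t := (d 0 0 * w 0 0 + d 0 1 * w 0 1 + d 0 2 * w 0 2) / dd.
have tE j1 j2 j3 : dd = d 0 j1 ^+ 2 + d 0 j2 ^+ 2 + d 0 j3 ^+ 2 ->
    d 0 0 * w 0 0 + d 0 1 * w 0 1 + d 0 2 * w 0 2 =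
    d 0 j1 * w 0 j1 + d 0 j2 * w 0 j2 + d 0 j3 * w 0 j3 ->
    d 0 j1 * w 0 j2 = d 0 j2 * w 0 j1 -> d 0 j1 * w 0 j3 = d 0 j3 * w 0 j1 ->
    w 0 j1 = t * d 0 j1.
  move=> e1 e2 e3 e4; apply: (mulfI dd_neq0).
  rewrite mulrA [dd * t]mulrC divfK // e1 e2.
  apply/eqP; rewrite -subr_eq0; apply/eqP.
  transitivity (d 0 j2 * (d 0 j2 * w 0 j1 - d 0 j1 * w 0 j2) +
    d 0 j3 * (d 0 j3 * w 0 j1 - d 0 j1 * w 0 j3)); first by ring.
  by rewrite e3 e4 !subrr !mulr0 addr0.
move=> s /= /imfsetP[s' /=]; rewrite !inE => /orP[/orP[]|] /eqP-> ->.
- by exists 0; rewrite scale0r addr0.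
- by exists 1; rewrite scale1r /d addrC subrK.
- exists t; rewrite -/(pt i) -[LHS](subrK P) addrC; congr (_ + _).
  rewrite -/w; apply: row3P; rewrite [RHS]mxE.
  + by apply: (tE 0 1 2) => //.
  + by apply: (tE 1 0 2); rewrite ?h2 ?h0 // /dd; ring.
  + by apply: (tE 2 0 1); rewrite ?h1 ?h0 // /dd; ring.
Qed.

Lemma card_spheres_through_pair :
  (#|` S| - 2 <= 11 * #|[set e in sphere_traces S | (p \in e) && (q \in e)]|)%N.
Proof.
have [e [f [k [k0 c0 c1 c2]]]] := ex_frame d_neq0.
(* The bisector plane of [p] and [q] is parametrized by [ctr]; the line of the
   point [i] in it is [ev a b c i u v = 0]. *)
pose wx i j := pt i 0 j - P 0 j.
pose a (i : I) := - 2 * (e 0 0 * wx i 0 + e 0 1 * wx i 1 + e 0 2 * wx i 2).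
pose b (i : I) := - 2 * (f 0 0 * wx i 0 + f 0 1 * wx i 1 + f 0 2 * wx i 2).
pose c (i : I) := wx i 0 ^+ 2 + wx i 1 ^+ 2 + wx i 2 ^+ 2 -
  (d 0 0 * wx i 0 + d 0 1 * wx i 1 + d 0 2 * wx i 2).
pose ctr u v := P + 2^-1 *: d + u *: e + v *: f.
have ctrE u v j : ctr u v 0 j = P 0 j + 2^-1 * d 0 j + u * e 0 j + v * f 0 j.
  by rewrite /ctr !mxE.
have qE j : val q 0 j = P 0 j + d 0 j by rewrite /d !mxE addrCA subrr addr0.
(* The terms quadratic in the centre cancel, so equidistance from [p] and [pt i] is a linear
   condition on [(u, v)]. *)
have key u v i : sqd (pt i) (ctr u v) = sqd P (ctr u v) + ev a b c i u v.
  by rewrite /ev /a /b /c /wx !sqdE !ctrE; field.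
have ed : e 0 0 * d 0 0 + e 0 1 * d 0 1 + e 0 2 * d 0 2 = 0.
  apply: (mulfI k0); rewrite mulr0 !mulrDr !(mulrCA k) -c0 -c1 -c2; ring.
have fd : f 0 0 * d 0 0 + f 0 1 * d 0 1 + f 0 2 * d 0 2 = 0.
  apply: (mulfI k0); rewrite mulr0 !mulrDr !(mulrCA k) -c0 -c1 -c2; ring.
have keyq u v : sqd (val q) (ctr u v) = sqd P (ctr u v).
  apply/eqP; rewrite -subr_eq0; apply/eqP.
  transitivity (- 2 * u * (e 0 0 * d 0 0 + e 0 1 * d 0 1 + e 0 2 * d 0 2)
     - 2 * v * (f 0 0 * d 0 0 + f 0 1 * d 0 1 + f 0 2 * d 0 2)).
    by rewrite !sqdE !ctrE !qE; field.
  by rewrite ed fd !mulr0 subr0.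
have rad u v : 0 < sqd P (ctr u v).
  rewrite lt0r sqd_ge0 andbT; apply/eqP => h.
  have /eqP := pq; apply; apply: val_inj; rewrite -/P (sqd_eq0 h).
  by apply/esym/sqd_eq0; rewrite keyq.
pose sph u v := sphere (ctr u v) (Num.sqrt (sqd P (ctr u v))).
have sphE u v x : sph u v x <-> sqd x (ctr u v) = sqd P (ctr u v).
  rewrite /sph; split; first by move=> /sphereP; rewrite sqrtr_gt0 sqr_sqrtr ?sqd_ge0 //; apply.
  by move=> h; apply/sphereP; rewrite ?sqrtr_gt0 // sqr_sqrtr // sqd_ge0.
have sph_sphere u v : is_sphere (sph u v).
  by exists (ctr u v), (Num.sqrt (sqd P (ctr u v))); rewrite sqrtr_gt0.
have sphI u v i : sph u v (pt i) <-> ev a b c i u v = 0.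
  rewrite sphE key; split => [/eqP|->]; last by rewrite addr0.
  by rewrite -subr_eq0 addrAC subrr add0r => /eqP.
have sphp u v : sph u v (val p) by apply/sphE.
have sphq u v : sph u v (val q) by apply/sphE.
have ptP (s : S) : [\/ s = p, s = q | exists i : I, ix i = s].
  have [->|sp] := eqVneq s p; first by constructor 1.
  have [->|sq] := eqVneq s q; first by constructor 2.
  have h : (s != p) && (s != q) by rewrite sp sq.
  by constructor 3; exists (exist _ s h).
have wE i j : (pt i - P) 0 j = wx i j by rewrite !mxE.
(* Otherwise [w = pt i - P] is orthogonal to [e] and [f]; expanding the cross product of [k *: d]
   and [w] as a triple product then gives zero, against [wedge_neq0]. *)
have line_neq0 i : (a i != 0) || (b i != 0).
  rewrite -negb_and; apply/negP => /andP[/eqP ai /eqP bi].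
  have two : - 2 != 0 :> R by lra.
  have {}ai : e 0 0 * wx i 0 + e 0 1 * wx i 1 + e 0 2 * wx i 2 = 0.
    by apply: (mulfI two); rewrite mulr0.
  have {}bi : f 0 0 * wx i 0 + f 0 1 * wx i 1 + f 0 2 * wx i 2 = 0.
    by apply: (mulfI two); rewrite mulr0.
  have cross (A B : R) j1 j2 (x1 x2 : R) : k * (d 0 j1 * x2) - k * (d 0 j2 * x1) =
      A * (e 0 0 * wx i 0 + e 0 1 * wx i 1 + e 0 2 * wx i 2) +
      B * (f 0 0 * wx i 0 + f 0 1 * wx i 1 + f 0 2 * wx i 2) ->
      d 0 j1 * x2 = d 0 j2 * x1.
    rewrite ai bi !mulr0 addr0 => /eqP; rewrite subr_eq0 => /eqP; exact: mulfI.
  apply: (@wedge_neq0 i); rewrite !wE.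
  - apply: (cross (f 0 0) (- e 0 0)); rewrite !mulrA -c1 -c2; ring.
  - apply: (cross (f 0 1) (- e 0 1)); rewrite !mulrA -c0 -c2; ring.
  - apply: (cross (f 0 2) (- e 0 2)); rewrite !mulrA -c0 -c1; ring.
have pt_set4 i j : i != j -> #|[set p; q; ix i; ix j]| = 4%N.
  move=> ij; have [ip iq] := pt_neq i; have [jp jq] := pt_neq j.
  rewrite -!finset.setUA !cardsU1 !inE !negb_or pq !(eq_sym p) !(eq_sym q) ip iq jp jq.
  by rewrite cards1 (inj_eq ix_inj) ij.
(* The determinant of [e], [f] and [d] is [k * dd], so [e] and [f] are independent. *)
have ctr_inj u v u' v' : ctr u v = ctr u' v' -> u = u' /\ v = v'.
  move=> h; have hj j : ctr u v 0 j = ctr u' v' 0 j by rewrite h.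
  have h' j : (u - u') * e 0 j + (v - v') * f 0 j = 0.
    have := hj j; rewrite !ctrE => /eqP; rewrite -subr_eq0 => /eqP <-; ring.
  have kd : k * dd != 0 by rewrite mulf_neq0.
  have kdE : k * dd = (e 0 1 * f 0 2 - e 0 2 * f 0 1) * d 0 0 +
      (e 0 2 * f 0 0 - e 0 0 * f 0 2) * d 0 1 + (e 0 0 * f 0 1 - e 0 1 * f 0 0) * d 0 2.
    by rewrite c0 c1 c2 /dd; ring.
  have h0 := h' 0; have h1 := h' 1; have h2 := h' 2.
  split; apply/eqP; rewrite -subr_eq0; apply/eqP; apply: (mulfI kd); rewrite mulr0 kdE.
  - transitivity (((u - u') * e 0 0 + (v - v') * f 0 0) * (f 0 2 * d 0 1 - f 0 1 * d 0 2)
      * (-1) + ((u - u') * e 0 1 + (v - v') * f 0 1) * (f 0 2 * d 0 0 - f 0 0 * d 0 2)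
      + ((u - u') * e 0 2 + (v - v') * f 0 2) * (f 0 0 * d 0 1 - f 0 1 * d 0 0)).
      by ring.
    by rewrite h0 h1 h2 !mul0r !addr0.
  - transitivity (((u - u') * e 0 0 + (v - v') * f 0 0) * (e 0 2 * d 0 1 - e 0 1 * d 0 2)
      + ((u - u') * e 0 1 + (v - v') * f 0 1) * (e 0 0 * d 0 2 - e 0 2 * d 0 0)
      + ((u - u') * e 0 2 + (v - v') * f 0 2) * (e 0 1 * d 0 0 - e 0 0 * d 0 1)).
      by ring.
    by rewrite h0 h1 h2 !mul0r !addr0.
(* Two common points would be the centres of two spheres through the same four points of [S]. *)
have meet_uniq i j u v u' v' : i != j ->
    ev a b c i u v = 0 -> ev a b c j u v = 0 ->
    ev a b c i u' v' = 0 -> ev a b c j u' v' = 0 -> u = u' /\ v = v'.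
  move=> ij iz jz iz' jz'; apply: ctr_inj; apply/eqP/negPn/negP => nc.
  apply: (not_concyclic (fset_val_sub [set p; q; ix i; ix j])).
    by rewrite card_fset_val pt_set4.
  apply: (two_spheres_concyclic (d1 := sqd P (ctr u v)) (d2 := sqd P (ctr u' v')) nc).
    by rewrite card_fset_val pt_set4.
  move=> s /imfsetP[s' /=]; rewrite !inE => /orP[/orP[/orP[]|]|] /eqP -> -> //.
  - by rewrite !key iz iz' !addr0.
  - by rewrite !key jz jz' !addr0.
have not_conc u v : exists i, ev a b c i u v != 0.
  apply: contrapT => h; apply: not_cospherical; exists (sph u v); split => // s /= sS.
  case: (ptP [` sS]%fset) => [/(congr1 val) /= ->|/(congr1 val) /= ->|[i /(congr1 val) /= <-]] //.
  by apply/sphI/eqP/negPn/negP => hi; apply: h; exists i.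
have i0 : exists i : I, True.
  apply: contrapT => h.
  have sub : (S `<=` [fset val p; val q])%fset.
    apply/fsubsetP => s sS; rewrite !inE.
    case: (ptP [` sS]%fset) => [/(congr1 val) /= ->|/(congr1 val) /= ->|[i _]].
    - by rewrite eqxx.
    - by rewrite eqxx orbT.
    - by case: h; exists i.
  have := leq_trans S5 (fsubset_leq_card sub); rewrite cardfs2.
  by case: (_ != _).
(* The vector [n] is normal to the plane of [p], [q] and [pt i]. By the Binet-Cauchy identity
   [det a b i j] is [4 * k] times the triple product of [d], [pt i - P] and [pt j - P], so if it
   vanishes for every [j], all of [S] lies in this plane. *)
have not_par : exists i j, det a b i j != 0.
  case: i0 => i _; apply: contrapT => h; apply: not_coplanar.
  pose n := row3 (d 0 1 * wx i 2 - d 0 2 * wx i 1) (d 0 2 * wx i 0 - d 0 0 * wx i 2)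
    (d 0 0 * wx i 1 - d 0 1 * wx i 0).
  exists (plane n (\sum_(j < 3) n 0 j * P 0 j)); split.
    exists n, (\sum_(j < 3) n 0 j * P 0 j); split => //; apply/eqP => n0.
    have n0E j : n 0 j = 0 by rewrite n0 mxE.
    apply: (@wedge_neq0 i); rewrite !wE; apply/eqP; rewrite -subr_eq0; apply/eqP.
    - by rewrite -(n0E 0) row3E.
    - by rewrite -(n0E 1) row3E.
    - by rewrite -(n0E 2) row3E.
  move=> s /= sS; rewrite /plane /= !sum3 !row3E.
  apply/eqP; rewrite -subr_eq0; apply/eqP.
  case: (ptP [` sS]%fset) => [/(congr1 val) /= ->|/(congr1 val) /= ->|[j /(congr1 val) /= <-]].
  - by rewrite /P subrr.
  - by rewrite !qE; ring.
  - rewrite -/(pt j).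
    have dij : det a b i j = 0 by apply/eqP/negPn/negP => hij; apply: h; exists i, j.
    have k4 : - 4 * k != 0 by rewrite mulf_neq0 //; lra.
    apply: (mulfI k4); rewrite mulr0.
    transitivity (- (4 * (((e 0 1 * f 0 2 - e 0 2 * f 0 1)) * (wx i 1 * wx j 2 - wx i 2 * wx j 1) +
       ((e 0 2 * f 0 0 - e 0 0 * f 0 2)) * (wx i 2 * wx j 0 - wx i 0 * wx j 2) +
       ((e 0 0 * f 0 1 - e 0 1 * f 0 0)) * (wx i 0 * wx j 1 - wx i 1 * wx j 0)))).
      by rewrite c0 c1 c2 /wx; ring.
    by rewrite -(oppr0 R) -dij /det /a /b; congr (- _); ring.
have := card_ordinary_pairs line_neq0 meet_uniq not_conc not_par.
have cardI : #|{: I}| = (#|` S| - 2)%N.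
  rewrite card_sig cardfE -(cardC (pred2 p q)) card2 pq addKn.
  by apply: eq_card => s; rewrite !inE negb_or.
rewrite cardI => /leq_trans; apply; rewrite leq_mul2l /=.
(* Adjoining [p] and [q] turns the two lines of a simple crossing into the trace of a four-point
   sphere. *)
pose g (z : {set I}) : {set S} := [set p; q] :|: [set ix i | i in z].
have gI z i : (ix i \in g z) = (i \in z).
  have [ip iq] := pt_neq i; rewrite /g !inE (negPf ip) (negPf iq) /=.
  by rewrite mem_imset //; exact: ix_inj.
have g_inj : injective g.
  by move=> z z' h; apply/finset.setP => i; rewrite -!gI h.
rewrite -(card_imset _ g_inj); apply: subset_leq_card.
apply/fintype.subsetP => _ /imsetP[z zo ->].
have gp : p \in g z by rewrite !inE eqxx.
have gq : q \in g z by rewrite !inE eqxx orbT.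
rewrite inE gp gq !andbT; move: zo; rewrite !inE => /andP[/eqP z2 /asboolP[u [v h]]].
apply/andP; split.
  rewrite /g cardsU cards2 pq card_imset; last exact: ix_inj.
  rewrite z2 (_ : _ :&: _ = finset.set0) ?cards0 //.
  apply/finset.setP => s; rewrite !inE; apply/negP => /andP[/orP[]/eqP-> /imsetP[i _ e']].
    by have [] := pt_neq i; rewrite -e' eqxx.
  by have [] := pt_neq i; rewrite -e' eqxx.
apply/asboolP; exists (sph u v); split => //; apply/finset.setP => s.
rewrite [s \in trace _ _]inE.
case: (ptP s) => [->|->|[i <-]].
- by rewrite gp; apply/asboolP.
- by rewrite gq; apply/asboolP.
- by rewrite gI -h; apply/asboolP/eqP => /sphI.
Qed.

End Pencil.

End Spheres.

(** The triples [(e, p, q)] with [p] and [q] distinct elements of [e] are counted first by [e], then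
    by the ordered pair. *)
Lemma double_count_pairs (T : finType) (F : {set {set T}}) (m k c : nat) :
  (forall e, e \in F -> #|e| = m) ->
  (forall p q : T, p != q ->
     k <= c * #|[set e in F | (p \in e) && (q \in e)]|)%N ->
  (#|T| * #|T|.-1 * k <= c * (#|F| * (m * m.-1)))%N.
Proof.
move=> Fm hk.
have card_pairs (B : {set T}) :
    (\sum_(p in B) \sum_(q in B | q != p) 1 = #|B| * #|B|.-1)%N.
  rewrite -sum_nat_const; apply: eq_bigr => p pB.
  rewrite sum1_card (cardsD1 p B) pB /=.
  by apply: eq_card => q; rewrite !inE andbC.
have -> : (#|F| * (m * m.-1) =
    \sum_(e in F) \sum_(p in e) \sum_(q in e | q != p) 1)%N.
  by rewrite -sum_nat_const; apply: eq_bigr => e eF; rewrite card_pairs Fm.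
rewrite (exchange_big_dep predT) //= -cardsT -card_pairs big_distrl big_distrr /=.
rewrite (eq_bigl predT) => [|p]; last by rewrite inE.
apply: leq_sum => p _; rewrite (exchange_big_dep (fun q => q != p)) /=; last first.
  by move=> e q _ /andP[].
rewrite big_distrl big_distrr /= (eq_bigl (fun q => q != p)) => [|q]; last by rewrite inE.
apply: leq_sum => q qp; rewrite mul1n sum1_card.
apply: leq_trans (hk p q _) _; first by rewrite eq_sym.
rewrite leq_mul2l; apply/orP; right; apply: eq_leq; apply: eq_card => e.
by rewrite [RHS]inE /= !inE qp andbT andbA.
Qed.

Lemma in_trace (R : realType) (S : {fset 'rV[R]_3}) A s :
  (s \in trace S A) = `[< A (val s) >].
Proof. by rewrite inE. Qed.

Lemma trace_fset_card (R : realType) (S : {fset 'rV[R]_3}) A :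
  #|trace S A| = #|` [fset x in S | x \in A]%fset|.
Proof.
rewrite -card_fset_val; congr (#|` _|); apply/fsetP => x.
rewrite !inE; apply/imfsetP/andP => [[s /= sA ->]|[xS xA]].
  split; first exact: (valP s).
  by move: sA; rewrite in_trace => /asboolP h; exact: mem_set h.
by exists [` xS]%fset => //=; rewrite in_trace; apply/asboolP/set_mem.
Qed.

(** * From traces back to spheres, and the final count *)

Section FourPointSpheres.
Variables (R : realType) (S : {fset 'rV[R]_3}).
Hypothesis not_concyclic :
  forall T, (T `<=` S)%fset -> #|` T| = 4%N -> ~ concyclic T.

Lemma trace_inj A B : is_sphere A -> is_sphere B -> #|trace S A| = 4%N ->
  trace S A = trace S B -> A = B.
Proof.
move=> sA sB A4 AB; have sub := fset_val_sub (trace S A).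
rewrite -card_fset_val in A4.
apply: (four_point_sphere_uniq A4 (not_concyclic sub A4) sA sB).
move=> _ /imfsetP[s /= h ->]; split.
  by move: h; rewrite in_trace => /asboolP.
by move: h; rewrite AB in_trace => /asboolP.
Qed.

Lemma card_sphere_traces :
  (#|sphere_traces S| <= #|` fset_set (four_point_spheres S)|)%N.
Proof.
(* Recovers a sphere from its trace; the default [set0] is never reached on [sphere_traces S]. *)
pose g (e : {set S}) := xget set0 [set A | is_sphere A /\ trace S A = e]%classic.
have gP A : is_sphere A -> #|trace S A| = 4%N -> g (trace S A) = A.
  move=> sA A4; have [] : is_sphere (g (trace S A)) /\ trace S (g (trace S A)) = trace S A.
    rewrite /g; have := @xgetPex _ set0 [set B | is_sphere B /\ trace S B = trace S A]%classic.
    by apply; exists A.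
  by move=> sB AB; apply/esym/trace_inj.
(* [fset_set] is empty on infinite sets, so finiteness has to be established: all these spheres are
   values of [g]. *)
have fin : finite_set (four_point_spheres S).
  apply: (@sub_finite_set _ _ (g @` setT)%classic); last exact/finite_image/finite_finset.
  by move=> A [sA]; rewrite -trace_fset_card => A4; exists (trace S A) => //; exact: gP.
have gE e : e \in sphere_traces S -> is_sphere (g e) /\ trace S (g e) = e.
  by rewrite inE => /andP[/eqP e4 /asboolP[A [sA Ae]]]; rewrite -Ae gP // Ae.
have g_inj : {in sphere_traces S &, injective g}.
  by move=> e e' /gE[_ h] /gE[_ h'] ee; rewrite -h ee h'.
have <- : #|` [fset g e | e in sphere_traces S]%fset| = #|sphere_traces S|.
  by rewrite card_in_imfset /= ?cardE.
apply: fsubset_leq_card; apply/fsubsetP => _ /imfsetP[e /= eF ->].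
rewrite in_fset_set // inE; have [sg tg] := gE e eF; split => //.
by rewrite -trace_fset_card tg; move: eF; rewrite inE => /andP[/eqP].
Qed.

End FourPointSpheres.

Theorem theorem6 (R : realType) (n : nat) (S : {fset 'rV[R]_3})
  (hn : (5 <= n)%N)
  (hS : #|` S| = n)
  (hsphere : ~ cospherical S)
  (hplane : ~ coplanar S)
  (hcircle : forall T : {fset 'rV[R]_3},
     (T `<=` S)%fset -> #|` T| = 4%N -> ~ concyclic T)
  (hline : forall T : {fset 'rV[R]_3},
     (T `<=` S)%fset -> #|` T| = 3%N -> ~ collinear T) :
  9 / 208 * ('C(n, 3))%:R <= (#|` fset_set (four_point_spheres S)|)%:R :> R.
Proof.
have h5 : (5 <= #|` S|)%N by rewrite hS.
set N := #|` _|.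
have FN : (#|sphere_traces S| <= N)%N := card_sphere_traces hcircle.
have count (p q : S) : p != q -> (n.-2 <= 11 * #|[set e in sphere_traces S | (p \in e) && (q \in e)]|)%N.
  move=> pq; have := card_spheres_through_pair pq h5 hsphere hplane hcircle hline.
  by rewrite hS subn2.
have F4 (e : {set S}) : e \in sphere_traces S -> #|e| = 4%N.
  by rewrite inE => /andP[/eqP].
have := double_count_pairs F4 count; rewrite -cardfE hS => hc.
have {hc} hC : ('C(n, 3) <= 22 * N)%N.
  (* Multiplication by [3! = 6] turns the binomial into n (n - 1) (n - 2), and 11 * 12 = 22 * 6. *)
  rewrite -(leq_pmul2r (fact_gt0 3)) bin_ffact !ffactnS ffactn0 muln1 mulnA.
  apply: leq_trans hc _; rewrite (_ : 3`! = 6)%N //; lia.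
have : ('C(n, 3))%:R <= 22 * N%:R :> R by rewrite -(natrM _ 22) ler_nat.
have : 0 <= N%:R :> R by exact: ler0n.
(* The factor 1 / 22 suffices because 9 * 22 = 198 is at most 208. *)
lra.
Qed.
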